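(* Let $\mu$ be a permuton and let $a,b\in(0,1)$. Then $\operatorname{Hom}(D_\mu^a,U_\mu^b)=0$, where $\operatorname{Hom}$ denotes morphisms of $\Lambda$-modules.
   Context: Let $\Bbbk$ be an algebraically closed field. $\Lambda_{\mathbb{R}}$ is the $\Bbbk$-linear category with objects the real numbers (plus a zero object) generated by morphisms $\alpha_{yx}:x\to y$ and $\alpha^*_{xy}:y\to x$ for $x<y$, with $\alpha_{xx}=\alpha^*_{xx}=1_x$, subject to: (1) $\alpha_{zy}\alpha_{yx}=\alpha_{zx}$ and $\alpha^*_{xy}\alpha^*_{yz}=\alpha^*_{xz}$ for $x\le y\le z$; (2) $\alpha^*_{x+a-b,x+a}\alpha_{x+a,x}=\alpha_{x+a-b,x-b}\alpha^*_{x-b,x}$ for $a,b>0$. $\Lambda=\Lambda_{(0,1)}$ is the quotient category of $\Lambda_{\mathbb{R}}$ obtained by setting every object $x\notin(0,1)$ isomorphic to zero. A morphism of $\Lambda$ is path like if it is a nonzero composition of $\alpha$'s and $\alpha^*$'s; the length of $\alpha_{yx}$ and of $\alpha^*_{xy}$ is $|x-y|$ and the length of a composition is the sum of the lengths. Path like morphisms $x\to y$ are determined by their length and form a basis of $\operatorname{Hom}_\Lambda(x,y)$. A $\Lambda$-module is a $\Bbbk$-linear functor $\Lambda\to\Bbbk\text{-}\mathrm{Vec}$ (left and right modules are identified via the isomorphism $\Lambda\cong\Lambda^{\mathrm{op}}$ fixing objects and exchanging $\alpha_{yx}$ and $\alpha^*_{xy}$), and $P_a=\operatorname{Hom}_\Lambda(a,-)$.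 A permuton is a measure $\mu$ on the Borel sets of $[0,1]\times[0,1]$ with $\mu([0,k]\times[0,1])=k=\mu([0,1]\times[0,k])$ for all $k\in[0,1]$. For a permuton $\mu$ and $a\in(0,1)$ let $f_{\mu,a}(x)=-2\mu([0,x]\times[0,a])+a+x$. $D_\mu^a$ is the submodule of $P_a$ for which $D_\mu^a(x)$ is spanned by the path like morphisms $a\to x$ of length at least $f_{\mu,a}(x)$, for $x\in(0,1)$, and $U_\mu^a=P_a/D_\mu^a$. *)

(* Defs.v *)
From HB Require Import structures.
From mathcomp Require Import all_boot all_order all_algebra.
From mathcomp Require Import all_classical all_reals all_analysis.
From mathcomp Require Import ring lra.
Set Implicit Arguments.
Unset Strict Implicit.
Unset Printing Implicit Defensive.
Import Order.TTheory GRing.Theory Num.Theory.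
Import numFieldNormedType.Exports.
Local Open Scope classical_set_scope.
Local Open Scope ring_scope.
Local Open Scope quotient_scope.

Section Subspace.
Context (k : fieldType) (V : lmodType k).

Record subspace := Subspace {
  subspace_set :> V -> Prop;
  subspace0 : subspace_set 0;
  subspaceP : forall (c : k) u v,
    subspace_set u -> subspace_set v -> subspace_set (c *: u + v) }.

Definition span (A : set V) : set V :=
  [set v | exists n (c : 'I_n -> k) (w : 'I_n -> V),
     (forall i, A (w i)) /\ v = \sum_(i < n) c i *: w i].

Lemma span0 A : span A 0.
Proof. by exists 0, (fun=> 0), (fun=> 0); split=> [[]//|]; rewrite big_ord0. Qed.

Lemma spanP A (c : k) u v : span A u -> span A v -> span A (c *: u + v).
Proof.
move=> [n [d [w [Aw ->]]]] [m [e [z [Az ->]]]].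
exists (n + m)%N.
exists (fun i => match fintype.split i with inl j => c * d j | inr j => e j end).
exists (fun i => match fintype.split i with inl j => w j | inr j => z j end).
split=> [i|]; first by case: fintype.split.
rewrite big_split_ord/= scaler_sumr; congr (_ + _); apply: eq_bigr => i _.
- by case: splitP => j /= ij; [rewrite scalerA; congr (_ * d _ *: w _); apply/val_inj
     | have := ltn_ord i; rewrite ij ltnNge leq_addr].
- case: splitP => j /= ij; first by have := ltn_ord j; rewrite -ij ltnNge leq_addr.
  by have -> : i = j by apply/val_inj/(@addnI n).
Qed.

Lemma span_sub A v : A v -> span A v.
Proof.
move=> Av; exists 1%N, (fun=> 1), (fun=> v); split=> //.
by rewrite big_ord1 scale1r.
Qed.

Definition span_subspace A := Subspace (span0 A) (@spanP A).

Lemma span_min A (S : subspace) : (forall v, A v -> S v) -> forall v, span A v -> S v.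
Proof.
move=> AS _ [n [c [w [Aw ->]]]]; elim: n c w Aw => [|n ih] c w Aw.
  by rewrite big_ord0; apply: subspace0.
rewrite big_ord_recl; apply: subspaceP; first exact: AS.
exact: ih.
Qed.

Definition zero_subspace : subspace.
Proof.
exists (fun v => v = 0) => // c u v -> -> /=; by rewrite scaler0 addr0.
Defined.

End Subspace.

Section SubQuot.
Context (k : fieldType) (V : lmodType k) (S : subspace V).

Definition subspace_pred : {pred V} := fun v => `[< S v >].

Lemma subspace_predP v : reflect (S v) (v \in subspace_pred).
Proof. exact: asboolP. Qed.

Lemma subspace_submod_closed : submod_closed subspace_pred.
Proof.
split; first exact/asboolP/subspace0.
by move=> c u v /asboolP Su /asboolP Sv; apply/asboolP/subspaceP.
Qed.

HB.instance Definition _ :=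
  GRing.isSubmodClosed.Build k V subspace_pred subspace_submod_closed.

Definition sub_space := {v : V | v \in subspace_pred}.
HB.instance Definition _ := SubChoice.on sub_space.
HB.instance Definition _ := [SubChoice_isSubLmodule of sub_space by <:].

Definition quot_space := Quotient.quot subspace_pred.
HB.instance Definition _ := GRing.Zmodule.on quot_space.

Definition quot_pi (v : V) : quot_space := \pi_(Quotient.quot subspace_pred) v.

Lemma quot_piP u v : quot_pi u = quot_pi v <-> S (u - v).
Proof.
rewrite /quot_pi; split=> [/eqP|].
  by rewrite -Quotient.idealrBE => /asboolP.
by move=> Suv; apply/eqP; rewrite -Quotient.idealrBE; apply/asboolP.
Qed.

Lemma quot_pi_surj (q : quot_space) : exists v, quot_pi v = q.
Proof. by exists (repr (q : Quotient.quot subspace_pred)); rewrite /quot_pi reprK. Qed.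

Lemma quot_piD u v : quot_pi (u + v) = quot_pi u + quot_pi v.
Proof. by rewrite /quot_pi Quotient.pi_add. Qed.

Definition quot_scale (c : k) (q : quot_space) : quot_space :=
  quot_pi (c *: repr (q : Quotient.quot subspace_pred)).

Lemma quot_piZ c v : quot_pi (c *: v) = quot_scale c (quot_pi v).
Proof.
apply/quot_piP; rewrite -scalerBr -[_ *: _]addr0.
apply: subspaceP; last exact: subspace0.
by apply/quot_piP; rewrite /quot_pi reprK.
Qed.

Fact quot_scalerA a b q : quot_scale a (quot_scale b q) = quot_scale (a * b) q.
Proof. by have [v <-] := quot_pi_surj q; rewrite -!quot_piZ scalerA. Qed.
Fact quot_scale1r : left_id 1 quot_scale.
Proof. by move=> q; have [v <-] := quot_pi_surj q; rewrite -quot_piZ scale1r. Qed.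
Fact quot_scalerDr : right_distributive quot_scale +%R.
Proof.
move=> c q r; have [u <-] := quot_pi_surj q; have [v <-] := quot_pi_surj r.
by rewrite -quot_piD -!quot_piZ -quot_piD scalerDr.
Qed.
Fact quot_scalerDl q : {morph quot_scale^~ q : a b / a + b}.
Proof.
by move=> a b; have [v <-] := quot_pi_surj q; rewrite -!quot_piZ -quot_piD scalerDl.
Qed.
HB.instance Definition _ := GRing.Zmodule_isLmodule.Build k quot_space
  quot_scalerA quot_scale1r quot_scalerDr quot_scalerDl.

Lemma quot_pi_linear : linear quot_pi.
Proof. by move=> c u v; rewrite quot_piD quot_piZ. Qed.

End SubQuot.

Record linCat (k : fieldType) := LinCat {
  ob :> Type;
  hom : ob -> ob -> lmodType k;
  idc : forall x, hom x x;
  compc : forall x y z, hom y z -> hom x y -> hom x z;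
  compc_linearr : forall x y z (g : hom y z), linear (@compc x y z g);
  compc_linearl : forall x y z (f : hom x y), linear (fun g => @compc x y z g f);
  comp1c : forall x y (f : hom x y), compc (idc y) f = f;
  compc1 : forall x y (f : hom x y), compc f (idc x) = f;
  compcA : forall x y z t (h : hom z t) (g : hom y z) (f : hom x y),
    compc h (compc g f) = compc (compc h g) f }.

Section CatModules.
Context (k : fieldType) (C : linCat k).

Record catModule := CatModule {
  mod_at :> C -> lmodType k;
  act : forall x y, hom x y -> mod_at x -> mod_at y;
  act_linearr : forall x y (f : hom x y), linear (act f);
  act_linearl : forall x y (v : mod_at x), linear (fun f : hom x y => act f v);
  act1 : forall x (v : mod_at x), act (idc x) v = v;
  act_comp : forall x y z (g : hom y z) (f : hom x y) v,
    act (compc g f) v = act g (act f v) }.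

Record modHom (M N : catModule) := ModHom {
  mod_app :> forall x, M x -> N x;
  mod_app_linear : forall x, linear (@mod_app x);
  mod_app_nat : forall x y (f : hom x y) v,
    mod_app (act f v) = act f (mod_app v) }.

Lemma modHom_ext (M N : catModule) (f g : modHom M N) :
  (forall x v, f x v = g x v) -> f = g.
Proof.
case: f => f fl fn; case: g => g gl gn /= fg.
have {}fg : f = g by apply: functional_extensionality_dep => x; apply/funext/fg.
by subst g; congr ModHom; exact: Prop_irrelevance.
Qed.

Lemma act0 (M : catModule) x y (f : hom x y) : act f (0 : M x) = 0.
Proof.
have := act_linearr f (-1) 0 (0 : M x).
by rewrite scaler0 addr0 scaleN1r addNr.
Qed.

Lemma act0l (M : catModule) x y (v : M x) : act (0 : hom x y) v = 0.
Proof.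
have := act_linearl v (-1) 0 (0 : hom x y).
by rewrite scaler0 addr0 scaleN1r addNr.
Qed.

Definition zeroHom (M N : catModule) : modHom M N.
Proof.
exists (fun x _ => 0) => [x c u v|x y f v]; first by rewrite scaler0 addr0.
by rewrite act0.
Defined.

Definition representable (a : C) : catModule :=
  @CatModule (fun x => hom a x) (fun x y => @compc k C a x y)
    (fun x y => @compc_linearr k C a x y)
    (fun x y => @compc_linearl k C a x y)
    (fun x => @comp1c k C a x)
    (fun x y z g f v => esym (compcA g f v)).

Record submodule (M : catModule) := Submodule {
  submod_at :> forall x, subspace (M x);
  submod_act : forall x y (f : hom x y) v,
    submod_at x v -> submod_at y (act f v) }.

Section SubQuotModule.
Context (M : catModule) (S : submodule M).

Definition sub_act x y (f : hom x y) (v : sub_space (S x)) : sub_space (S y) :=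
  exist _ (act f (\val v))
    (introT (subspace_predP _ _)
       (submod_act f (elimT (subspace_predP _ _) (valP v)))).

Definition subModule : catModule.
Proof.
exists (fun x => sub_space (S x)) sub_act => [x y f c u v|x y v c f g|x v|x y z g f v];
  apply: val_inj => /=.
- exact: act_linearr.
- exact: act_linearl.
- exact: act1.
- exact: act_comp.
Defined.

Definition quot_act x y (f : hom x y) (q : quot_space (S x)) : quot_space (S y) :=
  quot_pi (S y) (act f (repr (q : Quotient.quot (subspace_pred (S x))))).

Lemma quot_actE x y (f : hom x y) v :
  quot_act f (quot_pi (S x) v) = quot_pi (S y) (act f v).
Proof.
apply/quot_piP; set w := repr _.
have -> : act f w - act f v = act f (w - v).
  by rewrite -scaleN1r addrC -act_linearr scaleN1r addrC.
by apply: submod_act; apply/quot_piP; rewrite /quot_pi reprK.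
Qed.

Definition quotModule : catModule.
Proof.
exists (fun x => quot_space (S x)) quot_act => [x y f c q r|x y q c f g|x q|x y z g f q].
- have [u <-] := quot_pi_surj q; have [v <-] := quot_pi_surj r.
  by rewrite -quot_pi_linear !quot_actE act_linearr quot_pi_linear.
- have [v <-] := quot_pi_surj q.
  by rewrite !quot_actE act_linearl quot_pi_linear.
- by have [v <-] := quot_pi_surj q; rewrite quot_actE act1.
- by have [v <-] := quot_pi_surj q; rewrite !quot_actE act_comp.
Defined.

End SubQuotModule.
End CatModules.

(* Lam k J is the k-linear category presented by the objects Pt x (x : R) and
   Zero, the arrows Up : x -> y and Dn : y -> x for x <= y (identities when
   x = y), and the relations lam_up1 to lam_out; Hom spaces are formal k-linear
   expressions modulo the least k-linear congruence containing these relations.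
   Comp s t is "s after t". Relation lam_out makes every object outside J zero:
   J = setT gives the category on the whole real line, and J = the open unit
   interval gives its quotient Lam01. *)
Section Lambda.
Context (k : fieldType) (R : realType).

Inductive obj := Pt of R | Zero.

Inductive term : obj -> obj -> Type :=
| Id x : term x x
| Comp x y z : term y z -> term x y -> term x z
| Null x y : term x y
| Add x y : term x y -> term x y -> term x y
| Scale x y : k -> term x y -> term x y
| Up x y : x <= y -> term (Pt x) (Pt y)
| Dn x y : x <= y -> term (Pt y) (Pt x).

Arguments Up {x y}.
Arguments Dn {x y}.
Arguments Null {x y}.

Inductive lam_eq (J : set R) : forall x y, term x y -> term x y -> Prop :=
| lam_refl x y (s : term x y) : lam_eq J s s
| lam_sym x y (s t : term x y) : lam_eq J s t -> lam_eq J t s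
| lam_trans x y (s t u : term x y) : lam_eq J s t -> lam_eq J t u -> lam_eq J s u
| lam_cComp x y z (s s' : term y z) (t t' : term x y) :
    lam_eq J s s' -> lam_eq J t t' -> lam_eq J (Comp s t) (Comp s' t')
| lam_cAdd x y (s s' t t' : term x y) :
    lam_eq J s s' -> lam_eq J t t' -> lam_eq J (Add s t) (Add s' t')
| lam_cScale x y c (s s' : term x y) :
    lam_eq J s s' -> lam_eq J (Scale c s) (Scale c s')
| lam_addA x y (s t u : term x y) : lam_eq J (Add s (Add t u)) (Add (Add s t) u)
| lam_addC x y (s t : term x y) : lam_eq J (Add s t) (Add t s)
| lam_add0 x y (s : term x y) : lam_eq J (Add Null s) s
| lam_addN x y (s : term x y) : lam_eq J (Add (Scale (-1) s) s) Null
| lam_scaleA x y c d (s : term x y) :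
    lam_eq J (Scale c (Scale d s)) (Scale (c * d) s)
| lam_scale1 x y (s : term x y) : lam_eq J (Scale 1 s) s
| lam_scaleDr x y c (s t : term x y) :
    lam_eq J (Scale c (Add s t)) (Add (Scale c s) (Scale c t))
| lam_scaleDl x y c d (s : term x y) :
    lam_eq J (Scale (c + d) s) (Add (Scale c s) (Scale d s))
| lam_compDr x y z (s : term y z) (t u : term x y) :
    lam_eq J (Comp s (Add t u)) (Add (Comp s t) (Comp s u))
| lam_compDl x y z (s t : term y z) (u : term x y) :
    lam_eq J (Comp (Add s t) u) (Add (Comp s u) (Comp t u))
| lam_compZr x y z c (s : term y z) (t : term x y) :
    lam_eq J (Comp s (Scale c t)) (Scale c (Comp s t))
| lam_compZl x y z c (s : term y z) (t : term x y) :
    lam_eq J (Comp (Scale c s) t) (Scale c (Comp s t))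
| lam_comp1l x y (s : term x y) : lam_eq J (Comp (Id y) s) s
| lam_comp1r x y (s : term x y) : lam_eq J (Comp s (Id x)) s
| lam_compA x y z t (s : term z t) (u : term y z) (v : term x y) :
    lam_eq J (Comp s (Comp u v)) (Comp (Comp s u) v)
| lam_up1 x (h : x <= x) : lam_eq J (Up h) (Id (Pt x))
| lam_dn1 x (h : x <= x) : lam_eq J (Dn h) (Id (Pt x))
| lam_upup x y z (hxy : x <= y) (hyz : y <= z) (hxz : x <= z) :
    lam_eq J (Comp (Up hyz) (Up hxy)) (Up hxz)
| lam_dndn x y z (hxy : x <= y) (hyz : y <= z) (hxz : x <= z) :
    lam_eq J (Comp (Dn hxy) (Dn hyz)) (Dn hxz)
| lam_mesh x a b (ha : 0 < a) (hb : 0 < b)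
    (h1 : x <= x + a) (h2 : x + a - b <= x + a)
    (h3 : x - b <= x) (h4 : x - b <= x + a - b) :
    lam_eq J (Comp (Dn h2) (Up h1)) (Comp (Up h4) (Dn h3))
| lam_Zero : lam_eq J (Id Zero) Null
| lam_out x : ~ J x -> lam_eq J (Id (Pt x)) Null.

HB.instance Definition _ x y := gen_eqMixin (term x y).
HB.instance Definition _ x y := gen_choiceMixin (term x y).

Section Hom.
Context (J : set R).

Section HomSpace.
Context (x y : obj).

Definition lam_eqb (s t : term x y) : bool := `[< lam_eq J s t >].

Lemma lam_eqb_equiv : equiv_class_of lam_eqb.
Proof.
split=> [s|s t|t s u].
- exact/asboolP/lam_refl.
- by apply/asboolP/asboolP; exact: lam_sym.
- by move=> /asboolP st /asboolP tu; apply/asboolP; exact: lam_trans st tu.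
Qed.
Canonical lam_eqb_rel := EquivRelPack lam_eqb_equiv.

Definition lamHom := {eq_quot lam_eqb}.
HB.instance Definition _ := EqQuotient.on lamHom.
HB.instance Definition _ := Choice.on lamHom.

Definition cls (t : term x y) : lamHom := \pi_lamHom t.

Lemma clsP s t : cls s = cls t <-> lam_eq J s t.
Proof.
rewrite -[lam_eq J s t](asboolE) -/(lam_eqb s t); split=> [|h].
  by move=> /eqP; rewrite /cls piE.
by apply/eqP; rewrite /cls piE.
Qed.

Lemma reprP t : lam_eq J (repr (cls t)) t.
Proof. by apply/clsP; rewrite /cls reprK. Qed.

Lemma cls_surj (m : lamHom) : exists t, cls t = m.
Proof. by exists (repr m); rewrite /cls reprK. Qed.

Definition hadd (m n : lamHom) : lamHom := cls (Add (repr m) (repr n)).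
Definition hscale (c : k) (m : lamHom) : lamHom := cls (Scale c (repr m)).
Definition hopp (m : lamHom) : lamHom := hscale (-1) m.
Definition hzero : lamHom := cls Null.

Lemma clsD s t : cls (Add s t) = hadd (cls s) (cls t).
Proof. by apply/clsP/lam_sym/lam_cAdd; exact: reprP. Qed.
Lemma clsZ c s : cls (Scale c s) = hscale c (cls s).
Proof. by apply/clsP/lam_sym/lam_cScale; exact: reprP. Qed.

Fact haddA : associative hadd.
Proof.
move=> m n p; have [s <-] := cls_surj m; have [t <-] := cls_surj n.
by have [u <-] := cls_surj p; rewrite -!clsD; apply/clsP/lam_addA.
Qed.
Fact haddC : commutative hadd.
Proof.
move=> m n; have [s <-] := cls_surj m; have [t <-] := cls_surj n.
by rewrite -!clsD; apply/clsP/lam_addC.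
Qed.
Fact hadd0 : left_id hzero hadd.
Proof. by move=> m; have [s <-] := cls_surj m; rewrite -clsD; apply/clsP/lam_add0. Qed.
Fact haddN : left_inverse hzero hopp hadd.
Proof.
move=> m; have [s <-] := cls_surj m.
by rewrite /hopp -clsZ -clsD; apply/clsP/lam_addN.
Qed.
HB.instance Definition _ := GRing.isZmodule.Build lamHom haddA haddC hadd0 haddN.

Fact hscaleA a b m : hscale a (hscale b m) = hscale (a * b) m.
Proof. by have [s <-] := cls_surj m; rewrite -!clsZ; apply/clsP/lam_scaleA. Qed.
Fact hscale1 : left_id 1 hscale.
Proof. by move=> m; have [s <-] := cls_surj m; rewrite -clsZ; apply/clsP/lam_scale1. Qed.
Fact hscaleDr : right_distributive hscale +%R.
Proof.
move=> c m n; have [s <-] := cls_surj m; have [t <-] := cls_surj n.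
rewrite -[cls s + cls t]/(hadd _ _) -clsD -!clsZ -[RHS]/(hadd _ _) -clsD.
exact/clsP/lam_scaleDr.
Qed.
Fact hscaleDl m : {morph hscale^~ m : a b / a + b}.
Proof.
move=> a b; have [s <-] := cls_surj m.
by rewrite -!clsZ -[RHS]/(hadd _ _) -clsD; apply/clsP/lam_scaleDl.
Qed.
HB.instance Definition _ := GRing.Zmodule_isLmodule.Build k lamHom
  hscaleA hscale1 hscaleDr hscaleDl.

Lemma cls_add s t : cls (Add s t) = cls s + cls t.
Proof. exact: clsD. Qed.
Lemma cls_scale c s : cls (Scale c s) = c *: cls s.
Proof. exact: clsZ. Qed.

End HomSpace.

Definition hcomp x y z (g : lamHom y z) (f : lamHom x y) : lamHom x z :=
  cls (Comp (repr g) (repr f)).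

Lemma cls_comp x y z (s : term y z) (t : term x y) :
  cls (Comp s t) = hcomp (cls s) (cls t).
Proof. by apply/clsP/lam_sym/lam_cComp; exact: reprP. Qed.

Definition Lam : linCat k.
Proof.
apply: (@LinCat k obj lamHom (fun x => cls (Id x)) hcomp).
- move=> x y z g c f f'; have [s <-] := cls_surj g.
  have [t <-] := cls_surj f; have [u <-] := cls_surj f'.
  rewrite -cls_scale -cls_add -!cls_comp -cls_scale -cls_add; apply/clsP.
  apply: lam_trans (lam_compDr _ _ _ _) _; apply: lam_cAdd (lam_refl _ _).
  exact: lam_compZr.
- move=> x y z f c g g'; have [s <-] := cls_surj f.
  have [t <-] := cls_surj g; have [u <-] := cls_surj g'.
  rewrite -cls_scale -cls_add -!cls_comp -cls_scale -cls_add; apply/clsP.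
  apply: lam_trans (lam_compDl _ _ _ _) _; apply: lam_cAdd (lam_refl _ _).
  exact: lam_compZl.
- move=> x y f; have [s <-] := cls_surj f.
  by rewrite -cls_comp; apply/clsP/lam_comp1l.
- move=> x y f; have [s <-] := cls_surj f.
  by rewrite -cls_comp; apply/clsP/lam_comp1r.
- move=> x y z t h g f; have [s <-] := cls_surj h.
  have [u <-] := cls_surj g; have [v <-] := cls_surj f.
  by rewrite -!cls_comp; apply/clsP/lam_compA.
Defined.

Definition alpha (x y : R) (h : x <= y) : hom (Pt x : Lam) (Pt y) := cls (Up h).
Definition alphas (x y : R) (h : x <= y) : hom (Pt y : Lam) (Pt x) := cls (Dn h).

Inductive composite : forall x y : Lam, R -> hom x y -> Prop :=
| comp_alpha x y (h : x <= y) : composite (y - x) (alpha h)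
| comp_alphas x y (h : x <= y) : composite (y - x) (alphas h)
| comp_comp x y z l l' (g : hom y z) (f : hom x y) :
    composite l g -> composite l' f -> composite (l + l') (compc g f).

(* l is the length: alpha_yx and alpha*_xy have length y - x, and lengths add. *)
Definition path_like (x y : Lam) (l : R) (m : hom x y) := composite l m /\ m <> 0.

End Hom.
End Lambda.

Arguments Pt {R}.
Arguments Zero {R}.

Section Permuton.
Context (R : realType).

Definition square : Type := {p : R * R | (0 <= p.1 <= 1) && (0 <= p.2 <= 1)}.

HB.instance Definition _ := Choice.on square.

Fact square00 : (0 <= (0 : R) <= 1) && (0 <= (0 : R) <= 1).
Proof. by rewrite lexx ler01. Qed.
HB.instance Definition _ :=
  isPointed.Build square (exist _ (0 : R, 0 : R) square00).

Definition square_val (p : square) : measurableTypeR R * measurableTypeR R := \val p.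

(* The Borel sets of the square are the traces of the Borel sets of R * R; the
   latter form the product of the Borel sigma-algebra of R with itself. *)
Definition borel_square := g_sigma_algebra_preimageType square_val.

(* [0, x] * [0, y]: the lower bounds are automatic on the square. *)
Definition rect (x y : R) : set borel_square :=
  [set p | (square_val p).1 <= x /\ (square_val p).2 <= y].

Record permuton := Permuton {
  permuton_measure :> {measure set borel_square -> \bar R};
  permuton_fst : forall t : R, 0 <= t <= 1 -> permuton_measure (rect t 1) = t%:E;
  permuton_snd : forall t : R, 0 <= t <= 1 -> permuton_measure (rect 1 t) = t%:E }.

Definition fmu (mu : permuton) (a x : R) : R :=
  - 2 * fine (mu (rect x a)) + a + x.

Lemma measurable_rect x y : measurable (rect x y).
Proof.
exists ([set` `]-oo, x]] `*` [set` `]-oo, y]]).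
  by apply: measurableX; exact: measurable_itv.
rewrite setTI; apply/seteqP; split=> p /=; rewrite !in_itv//=.
Qed.

Lemma permuton_rectW (mu : permuton) a y : 0 <= y <= 1 ->
  (mu (rect y a) <= y%:E)%E.
Proof.
move=> y01; rewrite -(permuton_fst mu y01).
apply: le_measure; rewrite ?inE; [exact: measurable_rect..|].
move=> p [p1 _]; split=> //.
by have /andP[_ /andP[]] := valP p.
Qed.

Lemma permuton_rect_fin (mu : permuton) a y : 0 <= y <= 1 ->
  mu (rect y a) \is a fin_num.
Proof.
move=> y01; rewrite ge0_fin_numE//.
exact: le_lt_trans (permuton_rectW mu a y01) (ltry _).
Qed.

Lemma permuton_rect_incr (mu : permuton) a x y : 0 <= x -> x <= y -> y <= 1 ->
  0 <= fine (mu (rect y a)) - fine (mu (rect x a)) <= y - x.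
Proof.
move=> x0 xy y1.
have y01 : 0 <= y <= 1 by rewrite (le_trans x0 xy).
have x01 : 0 <= x <= 1 by rewrite x0 (le_trans xy y1).
have strip c : (mu (rect y c `\` rect x c) =
    (fine (mu (rect y c)) - fine (mu (rect x c)))%:E)%E.
  rewrite measureD; [|exact: measurable_rect..|].
    have -> : rect y c `&` rect x c = rect x c.
      apply/seteqP; split=> [p []//|p [p1 p2]]; split=> //; split=> //.
      exact: le_trans p1 xy.
    by rewrite EFinB !fineK//; exact: permuton_rect_fin.
  by rewrite -ge0_fin_numE//; exact: permuton_rect_fin.
have mD c : measurable (rect y c `\` rect x c).
  by apply: measurableD; exact: measurable_rect.
rewrite -lee_fin -[X in _ && X]lee_fin -strip measure_ge0/=.
have -> : (y - x)%:E = mu (rect y 1 `\` rect x 1).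
  by rewrite strip !permuton_fst.
apply: le_measure; rewrite ?inE; [exact: mD..|].
move=> p [[p1 p2] np]; have /andP[_ /andP[_ p21]] := valP p.
by split=> [//|[p1' _]]; apply: np.
Qed.

Lemma fmu_lipschitz (mu : permuton) a x y : 0 <= x -> x <= y -> y <= 1 ->
  `|fmu mu a y - fmu mu a x| <= y - x.
Proof.
move=> x0 xy y1; have /andP[] := permuton_rect_incr mu a x0 xy y1.
rewrite /fmu; set u := fine _; set v := fine _ => h1 h2.
by rewrite ler_norml; apply/andP; split; lra.
Qed.

End Permuton.

Section Modules.
Context (k : fieldType) (R : realType).

Definition Lam01 : linCat k := Lam k [set x : R | 0 < x < 1].

Definition Pmod (a : R) : catModule Lam01 := representable (Pt a : Lam01).

Definition D_at (mu : permuton R) (a : R) (x : Lam01) : subspace (Pmod a x) :=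
  match x return subspace (Pmod a x) with
  | Pt x => span_subspace [set m | exists2 l, fmu mu a x <= l & path_like l m]
  | Zero => zero_subspace _
  end.

Lemma act_tgt0 (M : catModule Lam01) (x y : Lam01) (f : hom x y) (v : M x) :
  idc y = 0 -> act f v = 0.
Proof. by move=> y0; rewrite -(act1 (act f v)) y0 act0l. Qed.

Lemma act_src0 (M : catModule Lam01) (x y : Lam01) (f : hom x y) (v : M x) :
  idc x = 0 -> act f v = 0.
Proof. by move=> x0; rewrite -(act1 v) x0 act0l act0. Qed.

Lemma idc_out (x : R) : ~ (0 < x < 1) -> idc (Pt x : Lam01) = 0.
Proof. by move=> nx; apply/clsP/lam_out. Qed.

Lemma D_act_gen (mu : permuton R) a (x y : R) (f : hom (Pt x : Lam01) (Pt y)) :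
  composite `|y - x| f -> forall v : Pmod a (Pt x),
  D_at mu a (Pt x) v -> D_at mu a (Pt y) (act f v).
Proof.
move=> cf; have [x01|nx] := pselect (0 < x < 1); last first.
  by move=> v _; rewrite act_src0 ?idc_out//; exact: span0.
have [y01|ny] := pselect (0 < y < 1); last first.
  by move=> v _; rewrite act_tgt0 ?idc_out//; exact: span0.
have [/andP[x0 x1] /andP[y0 y1]] := (x01, y01).
have S0 : D_at mu a (Pt y) (act f 0) by rewrite act0; exact: span0.
have SP c u v : D_at mu a (Pt y) (act f u) -> D_at mu a (Pt y) (act f v) ->
    D_at mu a (Pt y) (act f (c *: u + v)).
  by move=> Du Dv; rewrite act_linearr; exact: spanP.
apply: (@span_min _ _ _ (@Subspace _ (Pmod a (Pt x)) _ S0 SP)).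
move=> v [l fl [cv _]]; change (D_at mu a (Pt y) (act f (v : Pmod a (Pt x)))).
have [->|/eqP nz] := eqVneq (act f (v : Pmod a (Pt x))) 0; first exact: span0.
apply: span_sub; exists (`|y - x| + l); last by split=> //; exact: comp_comp.
have : `|fmu mu a y - fmu mu a x| <= `|y - x|.
  have [xy|yx] := leP x y.
    by rewrite (ger0_norm (_ : 0 <= y - x)) ?subr_ge0// fmu_lipschitz// ltW.
  rewrite distrC [leRHS]distrC (ger0_norm (_ : 0 <= x - y)) ?subr_ge0 ?(ltW yx)//.
  by rewrite fmu_lipschitz// ltW.
by move=> /(le_trans (ler_norm _)); lra.
Qed.

Lemma D_act (mu : permuton R) a (x y : Lam01) (f : hom x y) (v : Pmod a x) :
  D_at mu a x v -> D_at mu a y (act f v).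
Proof.
have [t <-] := cls_surj f; elim: t v => {x y f}.
- by move=> x v; rewrite (act1 v).
- move=> x y z s ihs t iht v Dv; rewrite cls_comp.
  by rewrite (act_comp (c := Pmod a) (x := x) (y := y) (z := z) (cls _ s) (cls _ t)); exact/ihs/iht.
- by move=> x y v _; rewrite (act0l (M := Pmod a)); exact: subspace0.
- move=> x y s ihs t iht v Dv; rewrite cls_add -[cls _ s]scale1r.
  by rewrite (act_linearl (c := Pmod a) (x := x) (y := y)); apply: subspaceP; [exact: ihs|exact: iht].
- move=> x y c s ihs v Dv; rewrite cls_scale -[_ *: _]addr0.
  rewrite (act_linearl (c := Pmod a) (x := x) (y := y)) (act0l (M := Pmod a)).
  by apply: subspaceP; [exact: ihs|exact: subspace0].
- move=> x y h v; apply: D_act_gen.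
  by rewrite ger0_norm ?subr_ge0//; exact: (comp_alpha _ _ h).
- move=> x y h v; apply: D_act_gen.
  by rewrite distrC ger0_norm ?subr_ge0//; exact: (comp_alphas _ _ h).
Qed.

Definition Dmod (mu : permuton R) (a : R) : submodule (Pmod a) :=
  @Submodule _ _ (Pmod a) (D_at mu a) (@D_act mu a).
Definition Umod (mu : permuton R) (a : R) : catModule Lam01 := quotModule (Dmod mu a).

End Modules.

(* Main.v *)
Require Import Defs.
From mathcomp Require Import all_boot all_order all_algebra.
From mathcomp Require Import all_classical all_reals all_analysis.
From mathcomp Require Import ring lra.
Import Order.TTheory GRing.Theory Num.Theory.
Local Open Scope ring_scope.

(** Write [F c x] for the mass of [[0, x] * [0, c]].  A path like morphism
    [a -> x] can be rewritten, by the mesh relations, as a descent from [a] to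
    a bottom point [s] followed by an ascent to [x] (a valley); its length is
    [a + x - 2 s], and it is nonzero exactly when
    [max (0, a + x - 1) < s <= min (a, x)].  In these terms the submodule
    [D^a (x)] is spanned by the valleys with [s <= F a x], and [U^b (x)] has
    for basis the valleys with [s > F b x].  Postcomposition with an ascent
    does not change [s]; postcomposition with a descent [x -> y] subtracts
    [x - y] from it.

    A homomorphism [phi] is thus described by the coefficients
    [entry x s r] (for [s <= F a x] and [r > F b x]) of the valley [r] in the
    image of the valley [s] at [x].  Naturality says that an entry is unchanged
    when [x] moves along an ascent or a descent, with [s] and [r] moving as
    above, as long as the new [r] stays above [F b] ([entry_up], [entry_dn]).

    Suppose first that [a <= b].  From [x], step left by a small [d] to
    [x' = x - d].  Pass through an intermediate point [y] of [[x', x]]: descend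
    from [x] to [y], then go back along the ascent [x' -> y].  With the right
    choice of [y] the bottom of the first valley becomes
    [s' = min (s, F a x')], which belongs to [D^a (x')], and [r] becomes
    [r - (s - s')].  Since [a <= b], the mass of a vertical strip is larger
    below [b] than below [a], so [F b] drops at least as much as [r] and the
    margin [r - F b x] does not shrink.  The step can be repeated with the same
    [d] until [x] is smaller than the margin; then [r > x], there is no valley
    [r] at [x], and the entry is zero ([entry0_left]).  If [b <= a] the same
    argument moves [x] to the right until [1 - x] is smaller than the margin,
    where [r > b] ([entry0_right]).  So all entries vanish, and [phi = 0].

    To read coefficients off at all one needs that the nonzero valleys are
    linearly independent, which a presentation by generators and relations
    does not give for free.  This is obtained by writing down the expected
    representation on functions of the bottom point and checking the relations
    on it ([transport_sound]). *)

Set Implicit Arguments.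
Unset Strict Implicit.
Unset Printing Implicit Defensive.

Local Notation hom := Defs.hom.
Local Notation span := Defs.span.
Local Notation subspace := Defs.subspace.

(** * The distribution function of a permuton *)

Section RectangleMass.
Context (R : realType) (mu : permuton R).

Definition mass (c x : R) : R := fine (mu (rect x c)).

Lemma rect_mono (x y c d : R) : x <= y -> c <= d ->
  (rect x c `<=` rect y d)%classic.
Proof. by move=> xy cd p [p1 p2]; split; [exact: le_trans xy|exact: le_trans cd]. Qed.

Lemma mass_incr c (x y : R) : 0 <= x -> x <= y -> y <= 1 ->
  0 <= mass c y - mass c x <= y - x.
Proof. exact: permuton_rect_incr. Qed.

Lemma mass0 c : mass c 0 = 0.
Proof.
have m0 : (mu (rect 0 c) = 0)%E.
  apply/eqP; rewrite eq_le measure_ge0 andbT.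
  by apply: permuton_rectW; rewrite lexx ler01.
by rewrite /mass m0.
Qed.

Lemma mass1 c : 0 <= c <= 1 -> mass c 1 = c.
Proof. by move=> c01; rewrite /mass permuton_snd. Qed.

Lemma mass_bounds c (x : R) : 0 <= c <= 1 -> 0 <= x <= 1 ->
  [/\ 0 <= mass c x, c + x - 1 <= mass c x, mass c x <= c & mass c x <= x].
Proof.
move=> c01 /andP[x0 x1].
have /andP[] := mass_incr c (lexx 0) x0 x1; rewrite mass0.
by have /andP[] := mass_incr c x0 x1 (lexx 1); rewrite mass1// => *; split; lra.
Qed.

Lemma mass_strip c (x y : R) : 0 <= x -> x <= y -> y <= 1 ->
  mu (rect y c `\` rect x c)%classic = (mass c y - mass c x)%:E.
Proof.
move=> x0 xy y1.
have y01 : 0 <= y <= 1 by rewrite (le_trans x0 xy).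
have x01 : 0 <= x <= 1 by rewrite x0 (le_trans xy y1).
rewrite measureD; [|exact: measurable_rect..|].
- rewrite setIidr; last exact: rect_mono.
  by rewrite EFinB !fineK//; exact: permuton_rect_fin.
- by rewrite -ge0_fin_numE//; exact: permuton_rect_fin.
Qed.

(** The strip between [x] and [y] cut at height [c] is contained in the one cut
    at height [d].  This is what decides, according to the order of [a] and [b],
    the direction in which entries of a homomorphism can be pushed. *)
Lemma mass_supermodular (c d x y : R) : c <= d -> 0 <= x -> x <= y -> y <= 1 ->
  mass c y - mass c x <= mass d y - mass d x.
Proof.
move=> cd x0 xy y1; rewrite -lee_fin -!mass_strip//.
apply: le_measure; rewrite ?inE; [by apply: measurableD; exact: measurable_rect..|].
move=> p [yp nxp]; split; first exact: rect_mono yp.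
by move=> [p1 _]; apply: nxp; split=> //; case: yp.
Qed.

End RectangleMass.

(** * A faithful model of the representable modules *)

Section Coefficients.
Context (k : fieldType) (R : realType) (b : R).
Local Notation J := [set x : R | 0 < x < 1]%classic.

(** The bottom points of the nonzero valleys from [b] to [x]; the lower bound
    [b + y - 1 < r] says that the top [b + y - r] of the opposite detour is
    less than 1.  The window is empty when [x] is outside the unit interval. *)
Definition window (x : obj R) (r : R) : bool :=
  if x is Pt y then [&& 0 < r, b + y - 1 < r, r <= b & r <= y] else false.

Definition clip (x : obj R) (g : R -> k) : R -> k :=
  fun r => if window x r then g r else 0.

(** A function [g] stands for the formal combination of valleys with
    coefficients [g r], so the identity has to act as [clip] and not as the
    identity of all functions.  A descent lowers bottom points by its length:
    the new coefficient at [r] is the old one at [r + (y - x)]. *)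
Fixpoint transport x y (t : term k x y) : (R -> k) -> R -> k :=
  match t with
  | Id x => clip x
  | Comp _ _ _ s t => fun g => transport s (transport t g)
  | Null _ _ => fun _ _ => 0
  | Add _ _ s t => fun g r => transport s g r + transport t g r
  | Scale _ _ c s => fun g r => c * transport s g r
  | Up x y _ => fun g => clip (Pt y) (clip (Pt x) g)
  | Dn x y _ => fun g => clip (Pt x) (fun r => clip (Pt y) g (r + (y - x)))
  end.

Lemma clip_id x g : clip x (clip x g) = clip x g.
Proof. by apply/funext => r; rewrite /clip; case: window. Qed.

Lemma transport_clipr x y (t : term k x y) g :
  transport t (clip x g) = transport t g.
Proof.
elim: t g => //= {x y} => [x g|x y z s _ t iht g|x y s ihs t iht g|x y c s ihs g|x y h g|x y h g].
- exact: clip_id.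
- by rewrite iht.
- by rewrite ihs iht.
- by rewrite ihs.
- by rewrite clip_id.
- by rewrite clip_id.
Qed.

Lemma transport_clipl x y (t : term k x y) g :
  clip y (transport t g) = transport t g.
Proof.
elim: t g => //= {x y} => [x g|x y g|x y s ihs t iht g|x y c s ihs g|x y h g|x y h g].
- exact: clip_id.
- by apply/funext => r; rewrite /clip if_same.
- by apply/funext => r; rewrite -[in RHS]ihs -[in RHS]iht /clip; case: window; rewrite ?addr0.
- by apply/funext => r; rewrite -[in RHS]ihs /clip; case: window; rewrite ?mulr0.
- exact: clip_id.
- exact: clip_id.
Qed.

Lemma transport_linear x y (t : term k x y) c g h :
  transport t (fun r => c * g r + h r) =
  (fun r => c * transport t g r + transport t h r).
Proof.
elim: t g h => //= {x y}
  [x|x y z s ihs t iht|x y|x y s ihs t iht|x y d s ihs|x y l|x y l] g h.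
- by apply/funext => r; rewrite /clip; case: window; rewrite ?mulr0 ?addr0.
- by rewrite iht ihs.
- by apply/funext => r; rewrite mulr0 addr0.
- by apply/funext => r; rewrite ihs iht; ring.
- by apply/funext => r; rewrite ihs; ring.
- by apply/funext => r; rewrite /clip; repeat case: ifP => _; rewrite ?mulr0 ?addr0.
- by apply/funext => r; rewrite /clip; repeat case: ifP => _; rewrite ?mulr0 ?addr0.
Qed.

Lemma transportD x y (t : term k x y) g h :
  transport t (fun r => g r + h r) = (fun r => transport t g r + transport t h r).
Proof.
have := transport_linear t 1 g h; under eq_fun do rewrite mul1r.
by move=> ->; under eq_fun do rewrite mul1r.
Qed.

Lemma transport0 x y (t : term k x y) : transport t (fun=> 0) = (fun=> 0).
Proof.
have := transport_linear t (-1) (fun=> 0) (fun=> 0).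
under eq_fun do rewrite mulr0 addr0.
by move=> ->; apply/funext => r; rewrite mulN1r addNr.
Qed.

Lemma transportZ x y (t : term k x y) c g :
  transport t (fun r => c * g r) = (fun r => c * transport t g r).
Proof.
have := transport_linear t c g (fun=> 0); under eq_fun do rewrite addr0.
by move=> ->; apply/funext => r; rewrite transport0 addr0.
Qed.

(** The relations hold in the model because a clip at an intermediate object
    does nothing when the composite stays inside both extreme windows; for the
    mesh relation, the windows at the top and at the bottom are both implied by
    those at the two sides. *)
Lemma transport_sound x y (s t : term k x y) :
  lam_eq J s t -> transport s = transport t.
Proof.
elim=> {x y s t}.
- by [].
- by move=> x y s t _ ->.
- by move=> x y s t u _ -> _ ->.
- by move=> x y z s s' t t' _ /= -> _ ->.
- by move=> x y s s' t t' _ /= -> _ ->.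
- by move=> x y c s s' _ /= ->.
- by move=> x y s t u /=; apply/funext => g; apply/funext => r; rewrite addrA.
- by move=> x y s t /=; apply/funext => g; apply/funext => r; rewrite addrC.
- by move=> x y s /=; apply/funext => g; apply/funext => r; rewrite add0r.
- by move=> x y s /=; apply/funext => g; apply/funext => r; rewrite mulN1r addNr.
- by move=> x y c d s /=; apply/funext => g; apply/funext => r; rewrite mulrA.
- by move=> x y s /=; apply/funext => g; apply/funext => r; rewrite mul1r.
- by move=> x y c s t /=; apply/funext => g; apply/funext => r; rewrite mulrDr.
- by move=> x y c d s /=; apply/funext => g; apply/funext => r; rewrite mulrDl.
- by move=> x y z s t u /=; apply/funext => g; rewrite transportD.
- by [].
- by move=> x y z c s t /=; apply/funext => g; rewrite transportZ.
- by [].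
- by move=> x y s /=; apply/funext => g; rewrite transport_clipl.
- by move=> x y s /=; apply/funext => g; rewrite transport_clipr.
- by [].
- by move=> x h /=; apply/funext => g; rewrite clip_id.
- move=> x h /=; apply/funext => g; apply/funext => r.
  by rewrite /clip subrr addr0; case: window.
- move=> x y z hxy hyz hxz /=; apply/funext => g; rewrite clip_id.
  apply/funext => r; rewrite /clip /window.
  cbv beta.
  case: ifP => // rz; case: ifP => // ry; case: ifP => // rx.
  by have := ry; rewrite (_ : [&& _, _, _ & _] = true)//; lra.
- move=> x y z hxy hyz hxz /=; apply/funext => g; rewrite clip_id.
  apply/funext => r; rewrite /clip /window.
  cbv beta.
  rewrite (_ : r + (y - x) + (z - y) = r + (z - x)); last by ring.
  case: ifP => // rx; case: ifP => // ry; case: ifP => // rz.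
  by have := ry; rewrite (_ : [&& _, _, _ & _] = true)//; lra.
- move=> x c d c0 d0 h1 h2 h3 h4 /=; apply/funext => g; rewrite !clip_id.
  apply/funext => r; rewrite /clip /window.
  cbv beta.
  rewrite (_ : r + (x + c - (x + c - d)) = r + d); last by ring.
  rewrite (_ : r + (x - (x - d)) = r + d); last by ring.
  case: ifP => // r1.
  case: (boolP [&& 0 < r + d, _, _ & r + d <= x]) => [r2|_]; last by rewrite !if_same.
  by rewrite !ifT//; lra.
- by apply/funext => g; apply/funext => r.
- move=> x nx /=; apply/funext => g; apply/funext => r; rewrite /clip /window.
  cbv beta.
  case: ifP => // rx; exfalso; apply: nx => /=; lra.
Qed.

(** The identity of [b] is the valley with bottom [b], whose coefficient
    function is the indicator of [b]. *)
Definition coef (x : obj R) (r : R) (m : lamHom k J (Pt b) x) : k :=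
  transport (repr m) (fun s => (s == b)%:R) r.

Lemma coef_cls x r (t : term k (Pt b) x) :
  coef r (cls J t) = transport t (fun s => (s == b)%:R) r.
Proof. by rewrite /coef (transport_sound (reprP J t)). Qed.

Lemma coef_window x r (m : lamHom k J (Pt b) x) : ~~ window x r -> coef r m = 0.
Proof.
by move=> /negbTE nw; rewrite /coef -transport_clipl /clip nw.
Qed.

Lemma coefP x r c (u v : lamHom k J (Pt b) x) :
  coef r (c *: u + v) = c * coef r u + coef r v.
Proof.
have [s <-] := cls_surj u; have [t <-] := cls_surj v.
by rewrite -cls_scale -cls_add !coef_cls.
Qed.

Lemma coef0 x r : coef r (0 : lamHom k J (Pt b) x) = 0.
Proof. by rewrite -[0]/(cls J (Null k (Pt b) x)) coef_cls. Qed.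

Lemma coef_alpha (x y : R) (h : x <= y) r
    (m : hom (Pt b : Lam01 k R) (Pt x)) : window (Pt y) r ->
  coef r (compc (alpha k J h) m) = coef r m.
Proof.
have [t <-] := cls_surj m => wr; rewrite -[compc _ _]/(hcomp (cls J _) (cls J t)) -cls_comp !coef_cls /=.
by rewrite transport_clipl /clip wr.
Qed.

Lemma coef_alphas (x y : R) (h : x <= y) r
    (m : hom (Pt b : Lam01 k R) (Pt y)) : window (Pt x) r ->
  coef r (compc (alphas k J h) m) = coef (r + (y - x)) m.
Proof.
have [t <-] := cls_surj m => wr; rewrite -[compc _ _]/(hcomp (cls J _) (cls J t)) -cls_comp !coef_cls /=.
by rewrite transport_clipl /clip wr.
Qed.

End Coefficients.

(** * Valleys span the morphism spaces *)

Section Valleys.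
Context (k : fieldType) (R : realType).
Local Notation J := [set x : R | 0 < x < 1]%classic.
Local Notation L := (Lam01 k R).
Local Notation up h := (alpha k J h).
Local Notation dn h := (alphas k J h).
Implicit Types (a b s x y z : R).

Lemma up_id x (h : x <= x) : up h = idc (Pt x : L).
Proof. exact/clsP/lam_up1. Qed.

Lemma dn_id x (h : x <= x) : dn h = idc (Pt x : L).
Proof. exact/clsP/lam_dn1. Qed.

Lemma up_up x y z (hxy : x <= y) (hyz : y <= z) (hxz : x <= z) :
  compc (up hyz) (up hxy) = up hxz.
Proof.
by rewrite -[LHS]/(hcomp (cls J _) (cls J _)) -cls_comp; apply/clsP/lam_upup.
Qed.

Lemma dn_dn x y z (hxy : x <= y) (hyz : y <= z) (hxz : x <= z) :
  compc (dn hxy) (dn hyz) = dn hxz.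
Proof.
by rewrite -[LHS]/(hcomp (cls J _) (cls J _)) -cls_comp; apply/clsP/lam_dndn.
Qed.

(** The mesh relation as a commutative square with top [t], bottom [s] and
    sides [x], [y], including the degenerate squares in which the top is one
    of the sides. *)
Lemma mesh x y t s (hx : x <= t) (hy : y <= t) (sx : s <= x) (sy : s <= y) :
  s = x + y - t -> compc (dn hy) (up hx) = compc (up sy) (dn sx).
Proof.
move=> def_s; have [xt|tx|xt] := ltgtP x t; last 2 first.
- by have := lt_le_trans tx hx; rewrite ltxx.
- subst t; have e : s = y by rewrite def_s addrAC subrr add0r.
  clear def_s; subst s; rewrite !up_id compc1 comp1c; congr alphas; exact: bool_irrelevance.
have [yt|ty|yt] := ltgtP y t; last 2 first.
- by have := lt_le_trans ty hy; rewrite ltxx.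
- subst t; have e : s = x by rewrite def_s addrK.
  by clear def_s; subst s; rewrite !dn_id compc1 comp1c; congr alpha; exact: bool_irrelevance.
have [c def_t] : exists c, t = x + c by exists (t - x); rewrite addrC subrK.
have [d def_y] : exists d, y = t - d by exists (t - y); rewrite subKr.
have e : s = x - d by rewrite def_s def_y; ring.
clear def_s; subst s y t.
have c0 : 0 < c by lra.
have d0 : 0 < d by lra.
rewrite -[LHS]/(hcomp (cls J _) (cls J _)) -[RHS]/(hcomp (cls J _) (cls J _)).
by rewrite -!cls_comp; apply/clsP/lam_mesh.
Qed.

(** Truncating the bottom point makes [valley] a total function of [s]; only
    the values [s <= min (a, x)] matter ([valleyE]). *)
Definition bottom a x s : R := Num.min s (Num.min a x).

Lemma bottom_src a x s : bottom a x s <= a.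
Proof. by rewrite /bottom !ge_min lexx !orbT. Qed.

Lemma bottom_tgt a x s : bottom a x s <= x.
Proof. by rewrite /bottom !ge_min lexx !orbT. Qed.

Definition valley a x s : hom (Pt a : L) (Pt x) :=
  compc (up (bottom_tgt a x s)) (dn (bottom_src a x s)).

Lemma valleyE a x s (sx : s <= x) (sa : s <= a) :
  valley a x s = compc (up sx) (dn sa).
Proof.
have e : bottom a x s = s by rewrite /bottom; apply/min_idPl; rewrite le_min sa sx.
rewrite /valley; move: (bottom_src a x s) (bottom_tgt a x s); rewrite e => h1 h2.
by rewrite (bool_irrelevance h1 sa) (bool_irrelevance h2 sx).
Qed.

Lemma valley_id a : valley a a a = idc (Pt a : L).
Proof. by rewrite (valleyE (lexx a) (lexx a)) up_id dn_id comp1c. Qed.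

Lemma up_valley a x y s (h : x <= y) : s <= a -> s <= x ->
  compc (up h) (valley a x s) = valley a y s.
Proof.
move=> sa sx; have sy := le_trans sx h.
by rewrite (valleyE sx sa) compcA (up_up _ _ sy) -valleyE.
Qed.

Lemma dn_valley a x y s (h : y <= x) : s <= a -> s <= x ->
  compc (dn h) (valley a x s) = valley a y (s - (x - y)).
Proof.
move=> sa sx; have s's : s - (x - y) <= s by lra.
have s'y : s - (x - y) <= y by lra.
rewrite (valleyE sx sa) compcA (mesh sx h s's s'y); last by ring.
by rewrite -compcA (dn_dn _ _ (le_trans s's sa)) -valleyE.
Qed.

Lemma compc0 (x y z : L) (g : hom y z) : compc g (0 : hom x y) = 0.
Proof. exact: (@act0 k L (representable x) y z g). Qed.

Lemma comp0c (x y z : L) (f : hom x y) : compc (0 : hom y z) f = 0.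
Proof. exact: (@act0l k L (representable x) y z f). Qed.

Lemma compc_through0 (x y z : L) (g : hom y z) (f : hom x y) :
  idc y = 0 -> compc g f = 0.
Proof. exact: (@act_src0 k R (representable x) y z g f). Qed.

(** Outside the window either the bottom point, or the top point of the detour
    on the other side of the mesh, is a zero object. *)
Lemma valley_out a x s : s <= a -> s <= x -> ~~ window a (Pt x) s ->
  valley a x s = 0.
Proof.
move=> sa sx; rewrite /window sa sx !andbT negb_and -!leNgt => /orP[s0|s1].
  by rewrite (valleyE sx sa) compc_through0// idc_out//; lra.
have at' : a <= a + x - s by lra.
have xt : x <= a + x - s by lra.
rewrite (valleyE sx sa) -(mesh at' xt sa sx); last by ring.
by rewrite compc_through0// idc_out//; lra.
Qed.

Lemma coef_valley b x s r : s <= b -> s <= x -> window b (Pt x) r ->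
  coef r (valley b x s) = (r == s)%:R.
Proof.
move=> sb sx wr; rewrite (valleyE sx sb) coef_alpha//.
rewrite -[dn sb]compc1; have [rs|nrs] := boolP (window b (Pt s) r); last first.
  rewrite coef_window//; case: eqVneq => // ers; subst r.
  by exfalso; move: wr nrs; rewrite /window; lra.
rewrite coef_alphas// coef_cls /= /clip.
rewrite ifT; last by move: rs wr; rewrite /window; lra.
by congr (_%:R); congr nat_of_bool; apply/eqP/eqP; lra.
Qed.

(** The length of a path determines it.  The claim is about the effect of the
    path on every valley, so that the induction goes through compositions; at
    the identity valley it gives [composite_valleyE].  The degenerate branch
    records that paths never meet the formal zero object. *)
Lemma composite_valley (x y : L) l (m : hom x y) : composite l m ->
  match x, y return hom (x : L) (y : L) -> Prop with
  | Pt p, Pt q => fun m => forall a s, s <= a -> s <= p ->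
      compc m (valley a p s) = valley a q (s - (l - (q - p)) / 2) /\
      `|q - p| <= l
  | _, _ => fun _ => False
  end m.
Proof.
elim=> {x y l m} [x y h|x y h|x y z l l' g f _ ihg _ ihf].
- move=> a s sa sx; rewrite ger0_norm ?subr_ge0//; split=> //.
  by rewrite up_valley// subrr mul0r subr0.
- move=> a s sa sx; rewrite distrC ger0_norm ?subr_ge0//; split=> //.
  by rewrite dn_valley//; congr valley; field.
- case: x y z g f ihg ihf => [p|] [q|] [r|] g f ihg ihf //.
  move=> a s sa sp; have [ef] := ihf a s sa sp.
  rewrite ler_norml => /andP[l1 l2].
  have [||eg] := ihg a (s - (l' - (q - p)) / 2); [lra|lra|].
  rewrite ler_norml => /andP[l3 l4]; split; last by rewrite ler_norml; lra.
  by rewrite -compcA ef eg; congr valley; field.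
Qed.

Lemma composite_valleyE a x l (m : hom (Pt a : L) (Pt x)) : composite l m ->
  m = valley a x ((a + x - l) / 2) /\ `|x - a| <= l.
Proof.
move=> cm; have [e ?] := composite_valley cm a a (lexx a) (lexx a); split=> //.
by rewrite -[m]compc1 -valley_id e; congr valley; field.
Qed.

Lemma valley_composite a x s : s <= a -> s <= x ->
  composite (a + x - 2 * s) (valley a x s).
Proof.
move=> sa sx; rewrite (_ : a + x - _ = (x - s) + (a - s)); last by ring.
by rewrite (valleyE sx sa); apply: comp_comp; [exact: comp_alpha|exact: comp_alphas].
Qed.

Definition valleys b (x : L) : set (hom (Pt b : L) x) :=
  match x with
  | Pt y => [set m | exists s, [/\ s <= b, s <= y & m = valley b y s]]%classic
  | Zero => set0
  end.
Arguments valleys : clear implicits.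

Lemma span_valleys_comp b (x y : L) (f : hom x y) (v : hom (Pt b : L) x) :
  span (valleys b x) v -> span (valleys b y) (compc f v).
Proof.
have gen (x' y' : L) (g : hom x' y') : 
    (forall v, valleys b x' v -> span (valleys b y') (compc g v)) ->
    forall v, span (valleys b x') v -> span (valleys b y') (compc g v).
  move=> gv; have S0 : span (valleys b y') (compc g 0).
    by rewrite compc0; exact: span0.
  have SP c u w : span (valleys b y') (compc g u) ->
      span (valleys b y') (compc g w) -> span (valleys b y') (compc g (c *: u + w)).
    by move=> gu gw; rewrite compc_linearr; exact: spanP.
  exact: (@span_min _ _ _ (Subspace S0 SP)).
have [t <-] := cls_surj f; elim: t v => {x y f}.
- by move=> x v; rewrite (comp1c (l := L)).
- move=> x y z s ihs t iht v Dv.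
  rewrite cls_comp -[hcomp _ _]/(compc (cls J s : hom (y : L) z) (cls J t : hom (x : L) y)).
  by rewrite -compcA; exact/ihs/iht.
- by move=> x y v _; rewrite comp0c; exact: span0.
- move=> x y s ihs t iht v Dv; rewrite cls_add -[cls _ s]scale1r.
  by rewrite (compc_linearl (l := L)); apply: spanP; [exact: ihs|exact: iht].
- move=> x y c s ihs v Dv; rewrite cls_scale -[_ *: _]addr0.
  rewrite (compc_linearl (l := L)) comp0c.
  by apply: spanP; [exact: ihs|exact: span0].
- move=> x y h; apply: gen => _ [s [sb sx ->]]; apply: span_sub; exists s.
  by split=> //; [exact: le_trans h|exact: up_valley].
- move=> x y h; apply: gen => _ [s [sb sy ->]]; apply: span_sub.
  by exists (s - (y - x)); split; [lra|lra|exact: dn_valley].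
Qed.

Lemma span_valleys b x (m : hom (Pt b : L) (Pt x)) : span (valleys b (Pt x)) m.
Proof.
rewrite -[m]compc1; apply: span_valleys_comp; apply: span_sub.
by exists b; rewrite valley_id.
Qed.

(** A spanning combination may use the same bottom point several times; the
    coefficients are recovered by asking for the expansion over every
    duplicate-free list that is large enough, a condition stable under linear
    combinations. *)
Lemma valley_expansion b x (m : hom (Pt b : L) (Pt x)) :
  exists S : seq R, m = \sum_(s <- S) coef s m *: valley b x s.
Proof.
pose T (m : hom (Pt b : L) (Pt x)) := exists S : seq R,
  forall S', uniq S' -> {subset S <= S'} ->
    m = \sum_(s <- S') coef s m *: valley b x s.
suff [S mS] : T m by exists (undup S); apply: mS => [|s]; rewrite ?undup_uniq ?mem_undup.
have T0 : T 0 by exists [::] => S' _ _; rewrite big1// => s _; rewrite coef0 scale0r.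
have TP c u v : T u -> T v -> T (c *: u + v).
  move=> [Su uS] [Sv vS]; exists (Su ++ Sv) => S' uS' sS'.
  have eu : u = \sum_(s <- S') coef s u *: valley b x s.
    by apply: uS => // s sS; apply: sS'; rewrite mem_cat sS.
  have ev : v = \sum_(s <- S') coef s v *: valley b x s.
    by apply: vS => // s sS; apply: sS'; rewrite mem_cat sS orbT.
  transitivity (c *: (\sum_(s <- S') coef s u *: valley b x s)
                + \sum_(s <- S') coef s v *: valley b x s).
    by congr (_ *: _ + _).
  rewrite scaler_sumr -big_split; apply: eq_bigr => s _ /=.
  by rewrite coefP scalerDl scalerA.
apply: (@span_min _ _ _ (Subspace T0 TP) _ _ (span_valleys m)) => _ [s [sb sx ->]].
exists [:: s] => S' uS' sS'; rewrite (bigD1_seq s) ?sS' ?mem_head//=.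
rewrite big1 ?addr0 => [|r nrs]; last first.
  have [wr|nwr] := boolP (window b (Pt x) r); last by rewrite coef_window// scale0r.
  by rewrite coef_valley// (negbTE nrs) scale0r.
have [ws|nws] := boolP (window b (Pt x) s); last by rewrite valley_out// scaler0.
by rewrite coef_valley// eqxx scale1r.
Qed.

End Valleys.

(** * The submodule and the quotient in terms of coefficients *)

Section Submodule.
Context (k : fieldType) (R : realType) (mu : permuton R).
Local Notation L := (Lam01 k R).
Implicit Types (a b s x : R).

Lemma D_valley a x s : s <= a -> s <= x -> s <= mass mu a x ->
  D_at mu a (Pt x) (valley k a x s).
Proof.
move=> sa sx sm; have [->|/eqP nz] := eqVneq (valley k a x s) 0; first exact: span0.
apply: span_sub; exists (a + x - 2 * s); last by split=> //; exact: valley_composite.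
by rewrite /fmu -/(mass mu a x); lra.
Qed.

Lemma D_gen a x (T : subspace (Pmod k a (Pt x))) :
  (forall s, s <= a -> s <= x -> s <= mass mu a x -> T (valley k a x s)) ->
  forall m, D_at mu a (Pt x) m -> T m.
Proof.
move=> Tv; apply: span_min => m [l fl [/composite_valleyE[-> xal] _]].
move: fl xal; rewrite /fmu -/(mass mu a x) ler_norml => fl /andP[l1 l2].
by apply: Tv; lra.
Qed.

Lemma D_coef b x r m : D_at mu b (Pt x) m -> mass mu b x < r -> coef (k := k) r m = 0.
Proof.
move=> Dm rm; have K0 : coef r (0 : hom (Pt b : L) (Pt x)) = 0 by exact: coef0.
have KP c (u v : hom (Pt b : L) (Pt x)) :
    coef r u = 0 -> coef r v = 0 -> coef r (c *: u + v) = 0.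
  by move=> u0 v0; rewrite coefP u0 v0 mulr0 addr0.
apply: (@D_gen b x (@Subspace _ (Pmod k b (Pt x)) _ K0 KP) _ m Dm) => s sb sx sm /=.
have [wr|nwr] := boolP (window b (Pt x) r); last by rewrite coef_window.
by rewrite coef_valley// gt_eqF// (le_lt_trans sm).
Qed.

Lemma coef_D b x (m : hom (Pt b : L) (Pt x)) :
  (forall r, mass mu b x < r -> coef r m = 0) -> D_at mu b (Pt x) m.
Proof.
move=> m0; have [S ->] := valley_expansion m.
elim: S => [|s S ih]; first by rewrite big_nil; exact: span0.
rewrite big_cons -[coef s m *: _]scale1r; apply: spanP ih.
have [wr|nws] := boolP (window b (Pt x) s); last first.
  by rewrite coef_window// scale0r; exact: span0.
have [sm|ms] := leP s (mass mu b x); last by rewrite m0// scale0r; exact: span0.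
rewrite -[coef s m *: _]addr0; apply: spanP; last exact: span0.
by case/and4P: wr => _ _ sb sx; apply: D_valley.
Qed.

End Submodule.

(** * Vanishing of homomorphisms *)

Section Homomorphisms.
Context (k : fieldType) (R : realType) (mu : permuton R) (a b : R).
Context (ha : 0 < a < 1) (hb : 0 < b < 1).
Local Notation J := [set x : R | 0 < x < 1]%classic.
Local Notation L := (Lam01 k R).
Local Notation up h := (alpha k J h).
Local Notation dn h := (alphas k J h).
Local Notation D := (subModule (Dmod k mu a)).
Local Notation U := (Umod k mu b).

Let a01 : 0 <= a <= 1. Proof. by move: ha => /andP[? ?]; lra. Qed.
Let b01 : 0 <= b <= 1. Proof. by move: hb => /andP[? ?]; lra. Qed.

(** Coercing by [insubd] keeps membership proofs out of the terms; on the
    submodule this is the inverse of the inclusion ([to_DK]). *)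
Definition to_D (x : R) (m : hom (Pt a : L) (Pt x)) : D (Pt x) :=
  insubd (0 : sub_space (D_at (k := k) mu a (Pt x))) m.

Lemma to_DK x (m : hom (Pt a : L) (Pt x)) : D_at mu a (Pt x) m ->
  \val (to_D m : sub_space (D_at (k := k) mu a (Pt x))) = m.
Proof. by move=> Dm; apply: insubdK; apply/asboolP. Qed.

Lemma to_D_act x y (f : hom (Pt x : L) (Pt y)) (m : hom (Pt a : L) (Pt x)) :
  D_at mu a (Pt x) m -> to_D (compc f m) = act f (to_D m).
Proof.
move=> Dm; apply: val_inj; rewrite to_DK; last exact: (D_act f Dm).
by rewrite /= to_DK.
Qed.

(** The choice of a representative does not matter for [r > F b x]
    ([ucoef_pi]): coefficients at such [r] vanish on the submodule. *)
Definition ucoef (x r : R) (q : U (Pt x)) : k :=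
  coef (b := b) (x := Pt x) r
    (repr (q : Quotient.quot (subspace_pred (D_at (k := k) mu b (Pt x))))).

Lemma ucoef_pi x r (w : hom (Pt b : L) (Pt x)) : mass mu b x < r ->
  ucoef r (quot_pi (D_at mu b (Pt x)) w : U (Pt x)) = coef r w.
Proof.
move=> mr; rewrite /ucoef; set q := repr _.
have Dq : D_at mu b (Pt x) (q - w) by apply/quot_piP; rewrite /quot_pi reprK.
have := D_coef Dq mr; rewrite addrC -scaleN1r coefP mulN1r addrC.
by move=> /eqP; rewrite subr_eq0 => /eqP.
Qed.

(** An ascent could only lose the coefficient at [r] by pushing [r] out of the
    window through its lower end; but [F b y] is at least both [0] and
    [b + y - 1], so this does not happen above [F b y]. *)
Lemma ucoef_up x y r (h : x <= y) (q : U (Pt x)) : 0 <= x -> y <= 1 ->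
  mass mu b y < r -> ucoef r (act (up h) q) = ucoef r q.
Proof.
move=> x0 y1 yr; have /andP[mxy _] := mass_incr mu b x0 h y1.
have xr : mass mu b x < r by lra.
have [w <-] := quot_pi_surj (q : quot_space (D_at mu b (Pt x))).
rewrite [act _ _](quot_actE (Dmod k mu b) (up h)) !ucoef_pi//.
have [wy|nwy] := boolP (window b (Pt y) r); first exact: coef_alpha.
rewrite !coef_window//; apply: contraNN nwy; rewrite /window.
have y01 : 0 <= y <= 1 by rewrite (le_trans x0 h) y1.
by have [_ ? _ _] := mass_bounds mu b01 y01; lra.
Qed.

Lemma ucoef_dn x y r (h : y <= x) (q : U (Pt x)) : 0 <= y -> x <= 1 ->
  mass mu b y < r - (x - y) -> ucoef (r - (x - y)) (act (dn h) q) = ucoef r q.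
Proof.
move=> y0 x1 yr; have /andP[_ mxy] := mass_incr mu b y0 h x1.
have xr : mass mu b x < r by lra.
have [w <-] := quot_pi_surj (q : quot_space (D_at mu b (Pt x))).
rewrite [act _ _](quot_actE (Dmod k mu b) (dn h)) !ucoef_pi//.
have [wy|nwy] := boolP (window b (Pt y) (r - (x - y))).
  by rewrite [LHS](coef_alphas h)// subrK.
rewrite !coef_window//; apply: contraNN nwy; rewrite /window.
have y01 : 0 <= y <= 1 by rewrite y0 (le_trans h x1).
by have [? _ _ _] := mass_bounds mu b01 y01; lra.
Qed.

Context (phi : modHom D U).

Definition entry x s r : k := ucoef r (phi (Pt x) (to_D (valley k a x s))).

Lemma entry_up x y s r : 0 <= x -> x <= y -> y <= 1 ->
  s <= mass mu a x -> mass mu b y < r -> entry y s r = entry x s r.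
Proof.
move=> x0 h y1 sm yr; have x01 : 0 <= x <= 1 by rewrite x0 (le_trans h y1).
have [_ _ ma mx] := mass_bounds mu a01 x01.
have [sa sx] : s <= a /\ s <= x by split; lra.
rewrite /entry -(up_valley k h sa sx) to_D_act; last exact: D_valley.
by rewrite mod_app_nat ucoef_up.
Qed.

Lemma entry_dn x y s r : 0 <= y -> y <= x -> x <= 1 ->
  s <= mass mu a x -> mass mu b y < r - (x - y) ->
  entry y (s - (x - y)) (r - (x - y)) = entry x s r.
Proof.
move=> y0 h x1 sm yr; have x01 : 0 <= x <= 1 by rewrite (le_trans y0 h).
have [_ _ ma mx] := mass_bounds mu a01 x01.
have [sa sx] : s <= a /\ s <= x by split; lra.
rewrite /entry -(dn_valley k h sa sx) to_D_act; last exact: D_valley.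
by rewrite mod_app_nat ucoef_dn.
Qed.

Lemma entry_large x s r : b < r \/ x < r -> entry x s r = 0.
Proof.
move=> br; apply: coef_window; rewrite /window; apply/negP => /and4P[_ _ ? ?].
by case: br; lra.
Qed.

(** The margin [e] bounds [r - F b x] below along the whole walk, which is why
    one step length, smaller than [e], serves for all the steps: the
    intermediate [r] exceeds [F b y] because it lost less than [e]. *)
Lemma entry0_left e x s r : a <= b -> 0 < e -> 0 <= x <= 1 ->
  s <= mass mu a x -> mass mu b x + e <= r -> entry x s r = 0.
Proof.
move=> ab e0 x01 sm gap; pose d := e / 2; have d0 : 0 < d by rewrite /d; lra.
have [n xn] : exists n : nat, x <= n%:R * d.
  exists (Num.bound (x / d)); rewrite -ler_pdivrMr//; apply/ltW/archi_boundP.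
  by rewrite divr_ge0// ?(ltW d0)//; case/andP: x01.
elim: n x s r x01 xn sm gap => [|n ih] x s r x01 xn sm gap.
  have [mb0 _ _ _] := mass_bounds mu b01 x01.
  by apply: entry_large; right; lra.
have [mb0 _ _ _] := mass_bounds mu b01 x01; have /andP[x0 x1] := x01.
have [xd|dx] := leP x d; first by apply: entry_large; right; rewrite /d in xd; lra.
pose x' := x - d; pose s' := Num.min s (mass mu a x').
have [x'0 x'x] : 0 <= x' /\ x' <= x by rewrite /x'; split; lra.
have x'1 := le_trans x'x x1.
have /andP[ma0 ma1] := mass_incr mu a x'0 x'x x1.
have /andP[mb1 mb2] := mass_incr mu b x'0 x'x x1.
have sup := mass_supermodular mu ab x'0 x'x x1.
have [s's s'm] : s' <= s /\ s' <= mass mu a x' by rewrite /s' !ge_min !lexx orbT.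
have ds : s - s' <= mass mu a x - mass mu a x'.
  by rewrite /s'; case: (leP s); lra.
have dd : x - x' = d by rewrite /x'; ring.
have d2 : d * 2 = e by rewrite /d; field.
(* On the descent from x to y the bottom s becomes s'. *)
pose y := x - (s - s').
have [x'y yx] : x' <= y /\ y <= x by rewrite /y; split; lra.
have y0 := le_trans x'0 x'y.
have /andP[mb3 mb4] := mass_incr mu b y0 yx x1.
have xy : x - y = s - s' by rewrite /y; ring.
have ym : mass mu b y < r - (s - s') by lra.
rewrite -(@entry_dn x y) ?xy// subKr (@entry_up x' y)//; last by lra.
apply: ih => //; [by rewrite x'0|move: xn; rewrite -natr1 mulrDl mul1r; lra|lra].
Qed.

(** The mirror image of [entry0_left].  Going right, the bottom [s] may rise by
    at most the step length, hence the minimum defining [s'].  Since [F b] grows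
    at most as fast as [F a] and as [x], it rises at most as much as [r] does,
    so the margin does not shrink. *)
Lemma entry0_right e x s r : b <= a -> 0 < e -> 0 <= x <= 1 ->
  s <= mass mu a x -> mass mu b x + e <= r -> entry x s r = 0.
Proof.
move=> ba e0 x01 sm gap; pose d := e / 2; have d0 : 0 < d by rewrite /d; lra.
have [n xn] : exists n : nat, 1 - x <= n%:R * d.
  exists (Num.bound ((1 - x) / d)); rewrite -ler_pdivrMr//; apply/ltW/archi_boundP.
  by rewrite divr_ge0// ?(ltW d0)//; case/andP: x01; lra.
have d2 : d * 2 = e by rewrite /d; field.
elim: n x s r x01 xn sm gap => [|n ih] x s r x01 xn sm gap.
  have [_ m1 _ _] := mass_bounds mu b01 x01.
  by apply: entry_large; left; lra.
have [_ m1 _ _] := mass_bounds mu b01 x01; have /andP[x0 x1] := x01.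
have [xd|dx] := leP (1 - x) d; first by apply: entry_large; left; lra.
pose x' := x + d; pose s' := Num.min (s + d) (mass mu a x').
have [xx' x'1] : x <= x' /\ x' <= 1 by rewrite /x'; split; lra.
have x'0 := le_trans x0 xx'.
have /andP[ma0 ma1] := mass_incr mu a x0 xx' x'1.
have /andP[mb1 mb2] := mass_incr mu b x0 xx' x'1.
have sup := mass_supermodular mu ba x0 xx' x'1.
have s'm : s' <= mass mu a x' by rewrite /s' !ge_min !lexx orbT.
have dd : x' - x = d by rewrite /x'; ring.
have [s's s'd] : s <= s' /\ s' <= s + d.
  by rewrite /s'; case: (leP (s + d)); split; lra.
have ds : mass mu b x' - mass mu b x <= s' - s.
  by rewrite /s'; case: (leP (s + d)); lra.
(* On the descent from x' to y the bottom s' becomes s. *)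
pose y := x' - (s' - s).
have [xy yx'] : x <= y /\ y <= x' by rewrite /y; split; lra.
have y1 := le_trans yx' x'1.
have /andP[mb3 mb4] := mass_incr mu b x0 xy y1.
have x'y : x' - y = s' - s by rewrite /y; ring.
have ym : mass mu b y < r by lra.
rewrite -(@entry_up x y)//.
have := @entry_dn x' y s' (r + (s' - s)); rewrite x'y subKr addrK => ->//; last exact: le_trans xy.
apply: ih => //; [by rewrite x'0|move: xn; rewrite -natr1 mulrDl mul1r; lra|lra].
Qed.

Lemma entry0 x s r : 0 <= x <= 1 -> s <= mass mu a x -> mass mu b x < r ->
  entry x s r = 0.
Proof.
move=> x01 sm mr; have e0 : 0 < r - mass mu b x by rewrite subr_gt0.
have gap : mass mu b x + (r - mass mu b x) <= r by lra.
have [ab|/ltW ba] := leP a b; [exact: entry0_left e0 _ _ gap|exact: entry0_right e0 _ _ gap].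
Qed.

Lemma quot_pi0 x : quot_pi (D_at (k := k) mu b x) 0 = 0.
Proof.
have := quot_pi_linear (D_at (k := k) mu b x) (-1) 0 0.
by rewrite scaler0 addr0 scaleN1r addNr.
Qed.

Lemma phi_valley x s : 0 <= x <= 1 -> s <= mass mu a x ->
  phi (Pt x) (to_D (valley k a x s)) = 0.
Proof.
move=> x01 sm; have [w ew] := quot_pi_surj
  (phi (Pt x) (to_D (valley k a x s)) : quot_space (D_at mu b (Pt x))).
rewrite -ew -quot_pi0; apply/quot_piP; rewrite subr0; apply: coef_D => r mr.
by rewrite -(ucoef_pi w mr) ew; exact: entry0.
Qed.

Lemma phi_D x (v : D (Pt x)) : 0 <= x <= 1 -> phi (Pt x) v = 0.
Proof.
move=> x01; have [_ _ ma mx] := mass_bounds mu a01 x01.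
pose T (m : Pmod k a (Pt x)) := D_at mu a (Pt x) m /\ phi (Pt x) (to_D m) = 0.
have T0 : T 0.
  split; first exact: subspace0.
  have -> : to_D (0 : hom (Pt a : L) (Pt x)) = (0 : sub_space _).
    by apply: val_inj; rewrite to_DK//; exact: subspace0.
  have := mod_app_linear phi (-1) (0 : D (Pt x)) 0.
  by rewrite scaler0 addr0 scaleN1r addNr.
have TP c u w : T u -> T w -> T (c *: u + w).
  move=> [Du u0] [Dw w0]; have Duw := subspaceP c Du Dw; split=> //.
  have -> : to_D (c *: u + w : Pmod k a (Pt x)) = c *: to_D u + to_D w.
    by apply: val_inj; rewrite to_DK// linearP /= !to_DK.
  by rewrite mod_app_linear u0 w0 scaler0 addr0.
have Dv := elimT (subspace_predP _ _) (valP (v : sub_space (D_at mu a (Pt x)))).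
have [|_] := @D_gen k R mu a x (Subspace T0 TP) _ _ Dv.
  move=> s sa sx sm; split; first exact: D_valley.
  exact: phi_valley.
by rewrite /to_D valKd.
Qed.

Lemma phi0 : phi = zeroHom D U.
Proof.
apply: modHom_ext => x v /=.
suff : idc x = 0 \/ phi x v = 0.
  by case=> [x0|//]; rewrite -(act1 (phi x v)) x0 act0l.
case: x v => [x|] v; last by left; apply/clsP/lam_Zero.
have [x01|nx] := pselect (0 < x < 1); last by left; exact: idc_out.
by right; apply: phi_D; case/andP: x01 => /ltW-> /ltW->.
Qed.

End Homomorphisms.

Theorem theorem3 (k : closedFieldType) (R : realType) (mu : permuton R)
    (a b : R) (ha : 0 < a < 1) (hb : 0 < b < 1)
    (phi : modHom (subModule (Dmod k mu a)) (Umod k mu b)) :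
  phi = zeroHom (subModule (Dmod k mu a)) (Umod k mu b).
Proof. exact: phi0. Qed.
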